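(* Let $A=\{a_1<a_2<\dots<a_n<\dots\}$ be an infinite subset of $\mathbb{N}=\{1,2,\dots\}$, let $g_n=a_{n+1}-a_n$, and let $\alpha,\beta$ be real numbers with $1\le\alpha\le\beta$. (i) If there exists a real sequence $(e_n)_{n=1}^\infty$ tending to zero such that, for each $n\ge1$, $$(1+e_n)\frac{\alpha}{n}\le\frac{g_n}{a_{n+1}},$$ then $\overline{\varepsilon}(A)\le\frac1\alpha$. (ii) If there exists a real sequence $(f_n)_{n=1}^\infty$ tending to zero such that, for each $n\ge1$, $$\frac{g_n}{a_n}\le\frac{\beta}{n}(1+f_n),$$ then $\frac1\beta\le\underline{\varepsilon}(A)$.
   Context: For an infinite set $A\subseteq\mathbb{N}$ and real $x$, let $A(x)=|A\cap[1,x]|$. The upper and lower exponential densities of $A$ are $\overline{\varepsilon}(A)=\limsup_{k\to\infty}\frac{\log A(k)}{\log k}$ and $\underline{\varepsilon}(A)=\liminf_{k\to\infty}\frac{\log A(k)}{\log k}$. If $A=\{a_1<a_2<\dots\}$, then equivalently $\overline{\varepsilon}(A)=\limsup_{n\to\infty}\frac{\log n}{\log a_n}$ and $\underline{\varepsilon}(A)=\liminf_{n\to\infty}\frac{\log n}{\log a_n}$. *)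

(* Defs.v *)
From HB Require Import structures.
From mathcomp Require Import all_boot all_order all_algebra finmap.
From mathcomp Require Import all_classical all_reals all_analysis.
Set Implicit Arguments.
Unset Strict Implicit.
Unset Printing Implicit Defensive.
Import Order.TTheory GRing.Theory Num.Theory.
Import numFieldNormedType.Exports.
Local Open Scope classical_set_scope.
Local Open Scope ring_scope.

(* The set being counted is finite for every x, so the junk value of fset_set
   on infinite sets is never reached. *)
Definition counting (R : realType) (A : set nat) (x : R) : nat :=
  #|` fset_set (A `&` [set n : nat | 1 <= n%:R :> R /\ n%:R <= x]) |.

(* The terms involving ln 0 or a division by ln 1 = 0 are
   finitely many when A is infinite, hence do not affect the limits. *)
Definition upper_exp_density (R : realType) (A : set nat) : \bar R :=
  limn_esup (fun k : nat => (ln (counting A (k%:R : R))%:R / ln (k%:R : R))%:E).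

Definition lower_exp_density (R : realType) (A : set nat) : \bar R :=
  limn_einf (fun k : nat => (ln (counting A (k%:R : R))%:R / ln (k%:R : R))%:E).

(* A = {a 1 < a 2 < ...}: indexing starts at 1 and a 0 is irrelevant. *)
Definition increasing_enumeration (A : set nat) (a : nat -> nat) : Prop :=
  (forall m n : nat, (0 < m)%N -> (m < n)%N -> (a m < a n)%N) /\
  A = a @` [set n : nat | (0 < n)%N].

Definition gap (R : realType) (a : nat -> nat) (n : nat) : R :=
  (a n.+1)%:R - (a n)%:R.

(* Main.v *)
Require Import Defs.
From mathcomp Require Import all_boot all_order all_algebra.
From mathcomp Require Import all_classical all_reals all_analysis.
From mathcomp Require Import lra ring.
Import Order.TTheory GRing.Theory Num.Theory.
Import numFieldNormedType.Exports.
Local Open Scope classical_set_scope.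
Local Open Scope ring_scope.

(** Write [g n = a n.+1 - a n].  The inequality
    [1 - x / y <= ln (y / x) <= y / x - 1] turns the hypotheses on relative
    gaps into hypotheses on increments of [ln (a n)]:
    [g n / a n.+1 <= ln (a n.+1) - ln (a n) <= g n / a n]
    ([relative_gap_bounds]).  The same inequality applied to consecutive
    integers compares [n^-1] with increments of [ln n] ([ln_succ_bounds]).
    Hence, for any [0 < c < alpha], hypothesis (i) makes the increments of
    [ln (a n)] dominate those of [c * ln n] once [e n] is small enough, and
    summing them gives [c * ln n <= ln (a n) + K] ([ln_enumeration_ge]).
    Dually, for [c > beta], hypothesis (ii) gives
    [ln (a n.+1) <= c * ln n + K] ([ln_enumeration_le]).

    If [m] is the number of elements of [A] up to [k], then
    [a m <= k < a m.+1], the first inequality being void when [m = 0]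
    ([counting_enumerationP]).  So (i) yields
    [c * ln m <= ln k + K] and (ii) yields [ln k <= c * ln m + K].  As [ln k]
    tends to infinity the constant [K] is negligible, and the upper
    (resp. lower) exponential density is at most (resp. at least) [c^-1]
    ([upper_exp_density_le], [lower_exp_density_ge]).  Letting [c] tend to
    [alpha] (resp. [beta]) concludes. *)

(** * Increments of the logarithm *)

Lemma sub_ln_le (R : realType) (x y : R) :
  0 < x -> 0 < y -> ln y - ln x <= (y - x) / x.
Proof.
move=> x0 y0; rewrite -ln_div ?posrE//.
have -> : y / x = 1 + (y - x) / x by field; rewrite gt_eqF.
apply: le_ln1Dx; rewrite mulrBl divff ?gt_eqF//.
by have := divr_gt0 y0 x0; lra.
Qed.

(** Increments of [ln (a n)] are squeezed between the two relative gaps that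
    occur in the hypotheses (i) and (ii). *)
Lemma relative_gap_bounds (R : realType) (a : nat -> nat) (n : nat) :
  (0 < a n)%N -> (0 < a n.+1)%N ->
  gap R a n / (a n.+1)%:R <= ln (a n.+1)%:R - ln (a n)%:R <=
  gap R a n / (a n)%:R.
Proof.
rewrite -!(ltr0n R) /gap => an0 an10; rewrite sub_ln_le// andbT.
by rewrite -lerN2 -mulNr !opprB sub_ln_le.
Qed.

(** The harmonic terms [n^-1] that bound the relative gaps are comparable with
    the increments of [ln n]; this is the previous lemma for the enumeration
    of all integers. *)
Lemma ln_succ_bounds (R : realType) (n : nat) :
  (0 < n)%N -> n.+1%:R^-1 <= ln (n.+1%:R : R) - ln n%:R <= n%:R^-1.
Proof.
move=> n0; have := relative_gap_bounds R id n n0 isT.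
by rewrite /gap -natrB// subSnn !mul1r.
Qed.

(** Since [ln 0 = 0], the case [n = 0] is included, so that the bounds on
    [ln] of a counting function stay meaningful for an empty count. *)
Lemma ln_nat_ge0 (R : realType) (n : nat) : 0 <= ln (n%:R : R).
Proof. by case: n => [|n]; [rewrite ln0|rewrite ln_ge0// ler1n]. Qed.

Lemma ln_nat_near_ge (R : realType) (M : R) :
  \forall k \near \oo, M <= ln (k%:R : R).
Proof.
near=> k; have k0 : 0 < (k%:R : R).
  by apply: lt_le_trans (expR_gt0 M) _; near: k; exact: nbhs_infty_ger.
rewrite -ler_expR lnK ?posrE//; near: k; exact: nbhs_infty_ger.
Unshelve. all: by end_near. Qed.

(** * Exponential densities from linear bounds on logarithms *)

Lemma limn_esup_le_near (R : realType) (u : nat -> \bar R) (l : \bar R) :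
  (\forall k \near \oo, (u k <= l)%E) -> (limn_esup u <= l)%E.
Proof.
move=> ul; rewrite /limn_esup /limf_esup.
apply: ge_ereal_inf; eexists; first by exists [set k | (u k <= l)%E].
by apply: ge_ereal_sup => _ [k ukl <-].
Qed.

(** Dividing by [c * ln k] gives [c^-1 + K / (c * ln k)], whose second term is
    below any [e > 0] as soon as [ln k >= K / (c * e)]. *)
Lemma upper_exp_density_le (R : realType) (A : set nat) (c K : R) :
  0 < c ->
  (forall k, (0 < k)%N ->
     c * ln (Defs.counting A (k%:R : R))%:R <= ln k%:R + K) ->
  (upper_exp_density R A <= c^-1%:E)%E.
Proof.
move=> c0 cK; apply/lee_addgt0Pr => e e0.
apply: limn_esup_le_near; near=> k.
have k0 : (0 < k)%N by near: k; exact: nbhs_infty_gt.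
have lnk1 : 1 <= ln (k%:R : R) by near: k; exact: ln_nat_near_ge.
have lnkK : K / (c * e) <= ln (k%:R : R) by near: k; exact: ln_nat_near_ge.
rewrite -EFinD lee_fin ler_pdivrMr; last exact: lt_le_trans lnk1.
rewrite -(ler_pM2l c0); apply: le_trans (cK _ k0) _.
rewrite mulrA mulrDr divff ?gt_eqF// mulrDl mul1r lerD2l.
by rewrite mulrC -ler_pdivrMr ?mulr_gt0.
Unshelve. all: by end_near. Qed.

Lemma lower_exp_density_ge (R : realType) (A : set nat) (c K : R) :
  0 < c ->
  (forall k, (0 < k)%N ->
     ln k%:R <= c * ln (Defs.counting A (k%:R : R))%:R + K) ->
  (c^-1%:E <= lower_exp_density R A)%E.
Proof.
move=> c0 cK; rewrite /lower_exp_density /limn_einf leeNr.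
apply/lee_addgt0Pr => e e0.
apply: limn_esup_le_near; near=> k.
have k0 : (0 < k)%N by near: k; exact: nbhs_infty_gt.
have lnk1 : 1 <= ln (k%:R : R) by near: k; exact: ln_nat_near_ge.
have lnkK : K / (c * e) <= ln (k%:R : R) by near: k; exact: ln_nat_near_ge.
rewrite -!EFinN -EFinD lee_fin lerNl opprD opprK.
rewrite ler_pdivlMr; last exact: lt_le_trans lnk1.
rewrite -(ler_pM2l c0) mulrA mulrBr divff ?gt_eqF// mulrBl mul1r.
have := cK _ k0; move: lnkK; rewrite ler_pdivrMr ?mulr_gt0//; lra.
Unshelve. all: by end_near. Qed.

(** * The counting function of an enumerated set *)

Lemma enumeration_ge (A : set nat) (a : nat -> nat) (n : nat) :
  increasing_enumeration A a -> (n <= a n.+1)%N.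
Proof.
move=> [ai _]; elim: n => // n IH; apply: leq_ltn_trans IH _; exact: ai.
Qed.

(** The elements of [A] up to [k] are exactly [a 1, ..., a m]. The index shift
    identifies them with the image of the [m] first naturals. *)
Lemma counting_enumeration (R : realType) (A : set nat) (a : nat -> nat)
    (k m : nat) :
  A `<=` [set n | (0 < n)%N] -> increasing_enumeration A a ->
  (0 < m -> a m <= k)%N -> (k < a m.+1)%N -> Defs.counting A (k%:R : R) = m.
Proof.
move=> A_pos [ai Aa] amk kam; apply: card_fset_set.
have amono i j : (0 < i)%N -> (i <= j)%N -> (a i <= a j)%N.
  by move=> i0; rewrite leq_eqVlt => /predU1P[->//|ij]; rewrite ltnW// ai.
have -> : A `&` [set n : nat | 1 <= n%:R :> R /\ n%:R <= k%:R :> R] =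
    (fun i => a i.+1) @` `I_m.
  apply/seteqP; split => [x [Ax []]|_ [i /= im <-]].
    rewrite ler_nat => _ xk; move: Ax; rewrite Aa => -[[//|i] _ aix] /=.
    exists i => //=; rewrite ltnNge; apply/negP => mi.
    by move: kam; rewrite ltnNge (leq_trans _ xk)// -aix amono.
  have Aai : A (a i.+1) by rewrite Aa; exists i.+1.
  split => //=; rewrite ler1n ler_nat; split; first exact: A_pos.
  by apply: leq_trans (amk _); [exact: amono|exact: leq_ltn_trans im].
apply: inj_card_eq => i j _ _ /eqP; apply: contraTeq.
rewrite neq_ltn => /orP[ij|ji]; first by rewrite neq_ltn (ai i.+1 j.+1).
by rewrite neq_ltn (ai j.+1 i.+1)// orbT.
Qed.

(** The count is the least [j] with [k < a j.+1]; minimality of [j] gives the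
    other inequality. *)
Lemma counting_enumerationP (R : realType) (A : set nat) (a : nat -> nat)
    (k : nat) :
  A `<=` [set n | (0 < n)%N] -> increasing_enumeration A a ->
  let m := Defs.counting A (k%:R : R) in
  ((0 < m -> a m <= k) /\ k < a m.+1)%N.
Proof.
move=> A_pos aA m.
have exk : exists m, (k < a m.+1)%N.
  by exists k.+1; exact: enumeration_ge aA.
case: (ex_minnP exk) => j kj jmin.
suff j0 : (0 < j -> a j <= k)%N.
  by rewrite /m (@counting_enumeration R A a k j).
case: j kj jmin => // j kj jmin _; rewrite leqNgt; apply/negP => /jmin.
by rewrite ltnn.
Qed.

(** * Growth of the enumeration *)

Lemma increments_le (R : realType) (u v : nat -> R) (N : nat) :
  (forall n, (N <= n)%N -> u n.+1 - u n <= v n.+1 - v n) ->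
  forall n, (N <= n)%N -> u n - u N <= v n - v N.
Proof.
move=> uv n /subnK <-; elim: (n - N)%N => [|d IH]; first by rewrite !subrr.
by have := uv _ (leq_addl d N); rewrite addSn; lra.
Qed.

(** Since [(1 + e n) * alpha] tends to [alpha > c], the increments of
    [c * ln n] are at most those of [ln (a n)] from some index on; the constant
    [K] absorbs the terms before it. *)
Lemma ln_enumeration_ge (R : realType) (a : nat -> nat) (c alpha : R)
    (e : nat -> R) :
  (forall n, (0 < n)%N -> (0 < a n)%N) -> 0 < c -> c < alpha ->
  e n @[n --> \oo] --> (0 : R) ->
  (forall n, (1 <= n)%N ->
     (1 + e n) * (alpha / n%:R) <= gap R a n / (a n.+1)%:R) ->
  exists2 K, 0 <= K & forall n, (0 < n)%N -> c * ln n%:R <= ln (a n)%:R + K.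
Proof.
move=> a_pos c0 c_alpha e0 gap_ge.
have : (1 + e n) * alpha @[n --> \oo] --> (1 + 0) * alpha.
  by apply: cvgMl; apply: cvgD => //; exact: cvg_cst.
rewrite addr0 mul1r => /cvgr_ge /(_ _ c_alpha) [N _ HN].
exists (c * ln N.+1%:R) => [|n n0]; first by rewrite mulr_ge0 ?ln_nat_ge0 ?ltW.
have [Nn|nN] := leqP N.+1 n; last first.
  rewrite -[leLHS]add0r lerD ?ln_nat_ge0// ler_pM2l// ler_ln ?posrE ?ltr0n//.
  by rewrite ler_nat ltnW.
have : c * ln n%:R - c * ln N.+1%:R <= ln (a n)%:R - ln (a N.+1)%:R.
  apply: (increments_le R (fun n => c * ln n%:R) (fun n => ln (a n)%:R)) Nn.
  move=> -[//|m] Nm.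
  have /andP[gap_le _] :=
    relative_gap_bounds R a m.+1 (a_pos m.+1 isT) (a_pos m.+2 isT).
  apply: le_trans gap_le; apply: le_trans (gap_ge m.+1 isT).
  rewrite mulrA -mulrBr; apply: le_trans (_ : c / m.+1%:R <= _).
    by rewrite ler_pM2l//; have /andP[] := ln_succ_bounds R m.+1 isT.
  by rewrite ler_pM2r ?invr_gt0// HN//= ltnW.
by have := ln_nat_ge0 R (a N.+1); lra.
Qed.

(** The increment [ln (a n.+2) - ln (a n.+1)] is at most
    [beta * (1 + f n.+1) / n.+1], hence at most [c / n.+1] from some [n] on,
    and [c / n.+1] is at most the increment of [c * ln n]: bounding [a n.+1],
    not [a n], makes the comparison of [n.+1^-1] with [ln n.+1 - ln n] go in
    the right direction.  It is also the bound needed for [k < a m.+1]. *)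
Lemma ln_enumeration_le (R : realType) (a : nat -> nat) (c beta : R)
    (f : nat -> R) :
  (forall n, (0 < n)%N -> (0 < a n)%N) ->
  (forall m n, (0 < m)%N -> (m < n)%N -> (a m < a n)%N) ->
  0 < c -> beta < c ->
  f n @[n --> \oo] --> (0 : R) ->
  (forall n, (1 <= n)%N ->
     gap R a n / (a n)%:R <= beta / n%:R * (1 + f n)) ->
  exists K, forall n, ln (a n.+1)%:R <= c * ln n%:R + K.
Proof.
move=> a_pos a_incr c0 beta_c f0 gap_le.
have : beta * (1 + f n) @[n --> \oo] --> beta * (1 + 0).
  by apply: cvgMr; apply: cvgD => //; exact: cvg_cst.
rewrite addr0 mulr1 => /cvgr_le /(_ _ beta_c) [N _ HN].
exists (ln (a N.+2)%:R) => n.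
have [Nn|nN] := leqP N.+1 n; last first.
  rewrite -[leLHS]add0r lerD ?mulr_ge0 ?ln_nat_ge0 ?(ltW c0)//.
  by rewrite ler_ln ?posrE ?ltr0n ?a_pos// ler_nat ltnW ?a_incr.
have : ln (a n.+1)%:R - ln (a N.+2)%:R <= c * ln n%:R - c * ln N.+1%:R.
  apply: (increments_le R (fun n => ln (a n.+1)%:R) (fun n => c * ln n%:R)) Nn.
  move=> -[//|m] Nm.
  have /andP[_ le_gap] :=
    relative_gap_bounds R a m.+2 (a_pos m.+2 isT) (a_pos m.+3 isT).
  apply: le_trans le_gap _; apply: le_trans (gap_le m.+2 isT) _.
  rewrite mulrAC -mulrBr; apply: le_trans (_ : c / m.+2%:R <= _).
    by rewrite ler_pM2r ?invr_gt0// HN//= ltnW// ltnW.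
  by rewrite ler_pM2l//; have /andP[] := ln_succ_bounds R m.+1 isT.
by have := mulr_ge0 (ltW c0) (ln_nat_ge0 R N.+1); lra.
Qed.

Theorem theorem3p8 (R : realType) (A : set nat) (a : nat -> nat)
    (alpha beta : R)
    (A_pos : A `<=` [set n : nat | (0 < n)%N])
    (A_inf : infinite_set A)
    (A_enum : increasing_enumeration A a)
    (alpha_ge1 : 1 <= alpha)
    (alpha_le_beta : alpha <= beta) :
  ((exists e : nat -> R, e n @[n --> \oo] --> (0 : R) /\
      forall n : nat, (1 <= n)%N ->
        (1 + e n) * (alpha / n%:R) <= gap R a n / (a n.+1)%:R) ->
    (upper_exp_density R A <= (1 / alpha)%:E)%E) /\
  ((exists f : nat -> R, f n @[n --> \oo] --> (0 : R) /\
      forall n : nat, (1 <= n)%N ->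
        gap R a n / (a n)%:R <= beta / n%:R * (1 + f n)) ->
    ((1 / beta)%:E <= lower_exp_density R A)%E).
Proof.
have a_pos n : (0 < n)%N -> (0 < a n)%N.
  by move=> n0; apply: A_pos; rewrite A_enum.2; exists n.
have alpha_gt0 : 0 < alpha by exact: lt_le_trans alpha_ge1.
have beta_gt0 : 0 < beta by exact: lt_le_trans alpha_le_beta.
rewrite !div1r; split => [[e [e0 gap_ge]]|[f [f0 gap_le]]].
- apply/lee_addgt0Pr => d d0; rewrite -EFinD.
  (* The exponent is [c = (alpha^-1 + d)^-1], for which [c^-1] is exactly the
     bound to reach. *)
  have s0 : 0 < alpha^-1 + d by rewrite addr_gt0 ?invr_gt0.
  have c_lt : (alpha^-1 + d)^-1 < alpha.
    by rewrite invf_plt ?posrE// ltrDl.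
  have [|K K0 cK] := ln_enumeration_ge R a _ alpha e a_pos _ c_lt e0 gap_ge.
    by rewrite invr_gt0.
  rewrite -[X in (_ <= X%:E)%E]invrK.
  apply: (@upper_exp_density_le _ _ _ K) => [|k k0]; first by rewrite invr_gt0.
  have [] := counting_enumerationP R A a k A_pos A_enum.
  case: (Defs.counting _ _) => [_ _|m /(_ isT) amk _].
    by rewrite ln0// mulr0 addr_ge0 ?ln_nat_ge0.
  apply: le_trans (cK m.+1 isT) _; rewrite lerD2r.
  by rewrite ler_ln ?posrE ?ltr0n ?a_pos// ler_nat.
- apply/lee_addgt0Pr => d d0; rewrite -leeBlDr// -EFinB.
  (* With this [c], [c / beta = 1 + d * beta <= 1 + d * c], that is
     [beta^-1 <= c^-1 + d]. *)
  pose c := beta * (1 + d * beta).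
  have c_gt : beta < c by rewrite ltr_pMr// ltrDl mulr_gt0.
  have c0 : 0 < c by exact: lt_trans c_gt.
  have [K cK] := ln_enumeration_le R a _ _ f a_pos A_enum.1 c0 c_gt f0 gap_le.
  apply: (@le_trans _ _ (c^-1)%:E).
    have cE : c / beta = 1 + d * beta by rewrite /c mulrAC divff ?gt_eqF// mul1r.
    rewrite lee_fin lerBlDr -(ler_pM2l c0) cE mulrDr divff ?gt_eqF//.
    by rewrite lerD2l mulrC ler_pM2r// ltW.
  apply: (@lower_exp_density_ge _ _ _ K) => // k k0.
  have [_] := counting_enumerationP R A a k A_pos A_enum => kam.
  apply: le_trans (cK _).
  by rewrite ler_ln ?posrE ?ltr0n ?a_pos// ler_nat ltnW.
Qed.
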